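(* A non-wasteful mechanism for online fair division is strategy-proof and envy-free ex ante if and only if it is ex ante equivalent to the Like mechanism.
   Context: Setting. An online fair division instance consists of a set of agents $N=\{1,\ldots,n\}$, an ordered set of indivisible items $O=\{o_1,\ldots,o_m\}$, and sincere utilities $u_{ij}\in\mathbb{R}_{\ge 0}$ of each agent $i\in N$ for each item $o_j$. It is supposed that at least one agent has positive utility for every item (otherwise the item can simply be discarded). Item $o_j$ arrives at round $j$, and each agent $i$ places a possibly strategic bid $v_{ij}\in\mathbb{R}_{\ge 0}$ for it (bidding sincerely means $v_{ij}=u_{ij}$). An (online) mechanism allocates $o_j$ immediately and irrevocably (possibly with randomization), with the allocation of $o_1,\ldots,o_{j-1}$ fixed and with no information about $o_{j+1},\ldots,o_m$; thus its behaviour on $o_1,\ldots,o_j$ depends only on the bids for $o_1,\ldots,o_j$. An allocation $\pi_j$ of $o_1,\ldots,o_j$ gives a bundle $\pi_{ji}$ to each agent $i$, with the bundles pairwise disjoint and with union $\{o_1,\ldots,o_j\}$; $\Pi_j$ is the set of all such allocations, and a mechanism induces a probability distribution over $\Pi_j$. A mechanism is non-wasteful if it shares the probability of 1 for each $o_j$ only among agents that bid positively for it if there is at least one such agent and, otherwise, discards $o_j$. Write $p_{ih}(\Pi_j)$ for the probability that agent $i$ receives item $o_h$ in this distribution, $\overline{u}_{ik}(\Pi_j)=\sum_{h=1}^{j}p_{kh}(\Pi_j)\,u_{ih}$ for the expected utility of agent $i$ for the expected allocation of agent $k$, and $\overline{u}_i=\overline{u}_{ii}$. Strategy-proof: for each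 instance with $m\in\mathbb{N}$ items, no agent $i\in N$ can strictly increase $\overline{u}_i(\Pi_m)$ by reporting any sequence $v_{i1},\ldots,v_{im}$ other than $u_{i1},\ldots,u_{im}$, supposing all other agents bid sincerely for $o_1,\ldots,o_m$. Envy-free ex ante (with all agents bidding sincerely): for each instance with $m\in\mathbb{N}$ items, $\overline{u}_{ii}(\Pi_m)\ge\overline{u}_{ik}(\Pi_m)$ for all $i,k\in N$. Two mechanisms are ex ante equivalent if, for each instance of $m\in\mathbb{N}$ items, each agent $i\in N$ and each item $o_j\in O$, the probabilities of $i$ for $o_j$ under both mechanisms are equal. Like mechanism: each arriving item $o_j$ is given to an agent chosen uniformly at random among the agents $i$ with $v_{ij}>0$ (independently of the earlier allocation). *)

(* Defs.v *)
From mathcomp Require Import all_boot all_order all_algebra.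

Set Implicit Arguments.
Unset Strict Implicit.
Unset Printing Implicit Defensive.

Import Order.TTheory GRing.Theory Num.Theory.
Local Open Scope ring_scope.

(* Agents are 'I_n; in an instance with m items the items are 'I_m, in order
   of arrival. Utilities and bids are matrices: u i j belongs to agent i and
   item j. *)

Definition nonneg_mx (R : realFieldType) (n m : nat) (v : 'M[R]_(n, m)) : Prop :=
  forall i j, 0 <= v i j.

Definition is_instance (R : realFieldType) (n m : nat) (u : 'M[R]_(n, m)) : Prop :=
  nonneg_mx u /\ forall j, exists i, 0 < u i j.

(* An item maps to its receiver, or to None if it is discarded; the bundle of
   agent i is the preimage of Some i, so bundles are disjoint and cover the
   items that are not discarded. *)
Definition allocation (n m : nat) := {ffun 'I_m -> option 'I_n}.

Definition bids_upto (R : realFieldType) (n m : nat) (v : 'M[R]_(n, m))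
    (j : 'I_m) : 'M[R]_(n, j.+1) :=
  \matrix_(i, h) v i (widen_ord (ltn_ord j) h).

Definition alloc_before (n m : nat) (pi : allocation n m)
    (j : 'I_m) : allocation n j :=
  [ffun h => pi (widen_ord (ltnW (ltn_ord j)) h)].

(* rule j v pi a is the conditional probability that the item arriving after j
   earlier ones gets outcome a, given the bids v up to and including this item
   and the allocation pi of the earlier ones. The number m of items and the
   later bids are not available to the rule. Only its values at nonnegative
   bids matter below. *)
Record mechanism (R : realFieldType) (n : nat) := Mechanism {
  rule : forall j : nat,
    'M[R]_(n, j.+1) -> allocation n j -> option 'I_n -> R;
  rule_ge0 : forall j v pi a, 0 <= @rule j v pi a;
  rule_sum1 : forall j v pi, \sum_a @rule j v pi a = 1
}.

Definition alloc_prob (R : realFieldType) (n m : nat) (M : mechanism R n)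
    (v : 'M[R]_(n, m)) (pi : allocation n m) : R :=
  \prod_(j < m) rule M (bids_upto v j) (alloc_before pi j) (pi j).

Definition outcome_prob (R : realFieldType) (n m : nat) (M : mechanism R n)
    (v : 'M[R]_(n, m)) (a : option 'I_n) (j : 'I_m) : R :=
  \sum_(pi : allocation n m | pi j == a) alloc_prob M v pi.

Definition agent_prob (R : realFieldType) (n m : nat) (M : mechanism R n)
    (v : 'M[R]_(n, m)) (i : 'I_n) (j : 'I_m) : R :=
  outcome_prob M v (Some i) j.

(* Expected utility, measured by the utilities u of agent i, of what agent k
   is expected to receive when the bids are v. *)
Definition exp_util (R : realFieldType) (n m : nat) (M : mechanism R n)
    (u v : 'M[R]_(n, m)) (i k : 'I_n) : R :=
  \sum_(h < m) agent_prob M v k h * u i h.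

Definition non_wasteful (R : realFieldType) (n : nat) (M : mechanism R n) : Prop :=
  forall (m : nat) (v : 'M[R]_(n, m)), nonneg_mx v -> forall j : 'I_m,
    ((exists i, 0 < v i j) -> \sum_(i | 0 < v i j) agent_prob M v i j = 1) /\
    (~ (exists i, 0 < v i j) -> outcome_prob M v None j = 1).

Definition misreport (R : realFieldType) (n m : nat) (u : 'M[R]_(n, m))
    (i : 'I_n) (w : 'rV[R]_m) : 'M[R]_(n, m) :=
  \matrix_(k, h) if k == i then w 0 h else u k h.

(* The misreport need not satisfy is_instance: an item that only agent i likes
   may end up with no positive bid. *)
Definition strategy_proof (R : realFieldType) (n : nat) (M : mechanism R n) : Prop :=
  forall (m : nat) (u : 'M[R]_(n, m)), is_instance u ->
  forall (i : 'I_n) (w : 'rV[R]_m), nonneg_mx w ->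
    exp_util M u (misreport u i w) i i <= exp_util M u u i i.

Definition envy_free_ex_ante (R : realFieldType) (n : nat) (M : mechanism R n) : Prop :=
  forall (m : nat) (u : 'M[R]_(n, m)), is_instance u ->
  forall i k : 'I_n, exp_util M u u i k <= exp_util M u u i i.

(* The probabilities of a mechanism are determined by bids, so they are compared
   for all bids that can be placed, including profiles in which some item gets
   no positive bid. Comparing only sincere bids of instances would not constrain
   what happens after an agent has withheld the only positive bid for an item,
   and hence could not imply strategy-proofness. *)
Definition ex_ante_equivalent (R : realFieldType) (n : nat)
    (M1 M2 : mechanism R n) : Prop :=
  forall (m : nat) (v : 'M[R]_(n, m)), nonneg_mx v ->
  forall (i : 'I_n) (j : 'I_m), agent_prob M1 v i j = agent_prob M2 v i j.

Definition positive_bidders (R : realFieldType) (n j : nat)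
    (v : 'M[R]_(n, j.+1)) : {set 'I_n} :=
  [set i | 0 < v i ord_max].

Definition like_rule (R : realFieldType) (n j : nat) (v : 'M[R]_(n, j.+1))
    (pi : allocation n j) (a : option 'I_n) : R :=
  match a with
  | Some i => if i \in positive_bidders v then #|positive_bidders v|%:R^-1 else 0
  | None => if positive_bidders v == set0 then 1 else 0
  end.

Lemma like_rule_ge0 (R : realFieldType) (n j : nat) (v : 'M[R]_(n, j.+1))
  (pi : allocation n j) (a : option 'I_n) : 0 <= like_rule v pi a.
Proof.
by case: a => [i|] /=; case: ifP => _; rewrite ?invr_ge0 ?ler0n ?ler01.
Qed.

Lemma like_rule_sum1 (R : realFieldType) (n j : nat) (v : 'M[R]_(n, j.+1))
  (pi : allocation n j) : \sum_a like_rule v pi a = 1.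
Proof.
rewrite (bigD1 None) //=.
rewrite (reindex_omap (op := +%R) Some id) /=; last by case.
under eq_bigl => i do rewrite eqxx.
rewrite -big_mkcond sumr_const.
case: eqP => [->|/eqP]; first by rewrite cards0 mulr0n addr0.
rewrite -card_gt0 => B0.
by rewrite add0r -[LHS]mulr_natr mulVf // pnatr_eq0 -lt0n.
Qed.

Definition like_mechanism (R : realFieldType) (n : nat) : mechanism R n :=
  Mechanism (@like_rule_ge0 R n) (@like_rule_sum1 R n).

(* Main.v *)
(* Let t agents bid for an item, which we may take to be the last one. By
   strategy-proofness the probability of a bidder i for it cannot grow when i
   bids differently; if i bids a huge amount w, the other bidders can have at
   most slightly more than i, since the envy of i on the earlier items is O(1)
   and that on the last one scales with w. Hence i has at least 1/t, and so has
   every bidder. This applies to profiles where every item gets a bid; in the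
   other profiles, where envy-freeness says nothing, strategy-proofness for an
   agent that values the unbid items at e -> 0 gives the bound 1/t from above. *)
Require Import Defs.
From mathcomp Require Import all_boot all_order all_algebra.
From mathcomp Require Import lra.

Set Implicit Arguments.
Unset Strict Implicit.
Unset Printing Implicit Defensive.

Import Order.TTheory GRing.Theory Num.Theory.
Local Open Scope ring_scope.

(** * Allocation probabilities, with the last item split off *)

Definition prefix_mx (R : realFieldType) (n m : nat) (v : 'M[R]_(n, m.+1)) :
    'M[R]_(n, m) :=
  \matrix_(i, h) v i (widen_ord (leqnSn m) h).

Definition alloc_rcons (n m : nat) (pi : allocation n m) (a : option 'I_n) :
    allocation n m.+1 :=
  [ffun h => if unlift ord_max h is Some h' then pi h' else a].

Lemma widen_lift (m : nat) (h : 'I_m) : widen_ord (leqnSn m) h = lift ord_max h.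
Proof. by apply: val_inj; rewrite /= /bump leqNgt ltn_ord. Qed.

Lemma alloc_rcons_max (n m : nat) (pi : allocation n m) a :
  alloc_rcons pi a ord_max = a.
Proof. by rewrite ffunE unlift_none. Qed.

Lemma alloc_rcons_widen (n m : nat) (pi : allocation n m) a h :
  alloc_rcons pi a (widen_ord (leqnSn m) h) = pi h.
Proof. by rewrite ffunE widen_lift liftK. Qed.

Lemma sum_allocS (R : realFieldType) (n m : nat) (P : pred (allocation n m.+1))
    (F : allocation n m.+1 -> R) :
  \sum_(pi | P pi) F pi =
  \sum_(pi : allocation n m) \sum_(a | P (alloc_rcons pi a)) F (alloc_rcons pi a).
Proof.
rewrite pair_big_dep /=.
rewrite (reindex (fun q : allocation n m * option 'I_n => alloc_rcons q.1 q.2)) //=.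
(* The inverse map restricts an allocation to the earlier items and reads off the outcome of the
   last. *)
exists (fun pi : allocation n m.+1 =>
  ([ffun h => pi (widen_ord (leqnSn m) h)] : allocation n m, pi ord_max)).
  move=> [pi a] _ /=; rewrite alloc_rcons_max; congr (_, _).
  by apply/ffunP => h; rewrite ffunE alloc_rcons_widen.
move=> pi _ /=; apply/ffunP => h; rewrite ffunE.
by case: unliftP => [h'|] ->; rewrite ?ffunE ?widen_lift.
Qed.

Lemma alloc_prob_rcons (R : realFieldType) (n m : nat) (M : mechanism R n)
    (v : 'M[R]_(n, m.+1)) (pi : allocation n m) a :
  alloc_prob M v (alloc_rcons pi a) = alloc_prob M (prefix_mx v) pi * rule M v pi a.
Proof.
rewrite /alloc_prob big_ord_recr /= alloc_rcons_max; congr (_ * _).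
  apply: eq_bigr => j _; rewrite alloc_rcons_widen.
  have -> : bids_upto v (widen_ord (leqnSn m) j) = bids_upto (prefix_mx v) j.
    by apply/matrixP => i h; rewrite !mxE; congr (v _ _); apply: val_inj.
  congr (rule M _ _ _); apply/ffunP => h.
  rewrite [LHS]ffunE [RHS]ffunE -(alloc_rcons_widen pi a).
  by congr (alloc_rcons _ _ _); apply: val_inj.
have -> : bids_upto v ord_max = v.
  by apply/matrixP => i h; rewrite !mxE; congr (v _ _); apply: val_inj.
congr (rule M _ _ _); apply/ffunP => h; rewrite ffunE -(alloc_rcons_widen pi a).
by congr (alloc_rcons _ _ _); apply: val_inj.
Qed.

Lemma alloc_prob_ge0 (R : realFieldType) (n m : nat) (M : mechanism R n)
    (v : 'M[R]_(n, m)) pi : 0 <= alloc_prob M v pi.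
Proof. by apply: prodr_ge0 => j _; apply: rule_ge0. Qed.

Lemma alloc_prob_sum1 (R : realFieldType) (n m : nat) (M : mechanism R n)
    (v : 'M[R]_(n, m)) : \sum_pi alloc_prob M v pi = 1.
Proof.
elim: m v => [|m IHm] v.
  rewrite (eq_bigr (fun=> 1)) => [|pi _]; last by rewrite /alloc_prob big_ord0.
  by rewrite sumr_const card_ffun card_ord expn0.
rewrite sum_allocS -[RHS](IHm (prefix_mx v)); apply: eq_bigr => pi _.
under eq_bigr do rewrite alloc_prob_rcons.
by rewrite -mulr_sumr rule_sum1 mulr1.
Qed.

(** This is where the mechanism being online enters: the conditional probabilities of the last item
    sum to 1 and drop out, so the last bids cannot influence earlier items. *)
Lemma outcome_prob_prefix (R : realFieldType) (n m : nat) (M : mechanism R n)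
    (v : 'M[R]_(n, m.+1)) a (j : 'I_m) :
  outcome_prob M v a (widen_ord (leqnSn m) j) = outcome_prob M (prefix_mx v) a j.
Proof.
rewrite /outcome_prob sum_allocS [RHS]big_mkcond /=; apply: eq_bigr => pi _.
under eq_bigl do rewrite alloc_rcons_widen.
case: ifP => _; last by rewrite big_pred0_eq.
under eq_bigr do rewrite alloc_prob_rcons.
by rewrite -mulr_sumr rule_sum1 mulr1.
Qed.

Lemma outcome_prob_last (R : realFieldType) (n m : nat) (M : mechanism R n)
    (v : 'M[R]_(n, m.+1)) a :
  outcome_prob M v a ord_max =
  \sum_pi alloc_prob M (prefix_mx v) pi * rule M v pi a.
Proof.
rewrite /outcome_prob sum_allocS; apply: eq_bigr => pi _.
under eq_bigl do rewrite alloc_rcons_max.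
by rewrite big_pred1_eq alloc_prob_rcons.
Qed.

Lemma outcome_prob_ge0 (R : realFieldType) (n m : nat) (M : mechanism R n)
    (v : 'M[R]_(n, m)) a j : 0 <= outcome_prob M v a j.
Proof. by apply: sumr_ge0 => pi _; apply: alloc_prob_ge0. Qed.

Lemma outcome_prob_sum1 (R : realFieldType) (n m : nat) (M : mechanism R n)
    (v : 'M[R]_(n, m)) j : \sum_a outcome_prob M v a j = 1.
Proof.
rewrite -(alloc_prob_sum1 M v).
by rewrite (partition_big (fun pi : allocation n m => pi j) predT).
Qed.

Lemma outcome_prob_None_sum (R : realFieldType) (n m : nat) (M : mechanism R n)
    (v : 'M[R]_(n, m)) j :
  outcome_prob M v None j + \sum_i agent_prob M v i j = 1.
Proof.
rewrite -[RHS](outcome_prob_sum1 M v j) [RHS](bigD1 None) //=; congr (_ + _).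
rewrite [RHS](reindex_omap (op := +%R) Some id) /=; last by case.
by apply: eq_bigl => i; rewrite eqxx.
Qed.

Lemma agent_prob_ge0 (R : realFieldType) (n m : nat) (M : mechanism R n)
    (v : 'M[R]_(n, m)) i j : 0 <= agent_prob M v i j.
Proof. exact: outcome_prob_ge0. Qed.

(** The positive bidders, or the discarding of the item, already take up the total probability 1,
    and the remaining terms are nonnegative. *)
Lemma non_wasteful_agent_prob_eq0 (R : realFieldType) (n m : nat)
    (M : mechanism R n) (v : 'M[R]_(n, m)) i j :
  non_wasteful M -> nonneg_mx v -> ~~ (0 < v i j) -> agent_prob M v i j = 0.
Proof.
move=> hM v0 vij; have [hpos hnone] := hM m v v0 j.
have sum1 := outcome_prob_None_sum M v j.
apply/eqP; rewrite eq_le agent_prob_ge0 andbT.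
have [/existsP ex|/existsP nex] := boolP [exists k, 0 < v k j].
  move: sum1; rewrite (bigID (fun k => 0 < v k j)) /= hpos // (bigD1 i) //=.
  set s := \sum_(k | _) _; have s0 : 0 <= s.
    by apply: sumr_ge0 => k _; apply: agent_prob_ge0.
  by have := outcome_prob_ge0 M v None j; lra.
move: sum1; rewrite hnone // (bigD1 i) //=.
set s := \sum_(k | _) _; have s0 : 0 <= s.
  by apply: sumr_ge0 => k _; apply: agent_prob_ge0.
by lra.
Qed.

(** * The probabilities of the Like mechanism in closed form *)

Definition bidders (R : realFieldType) (n m : nat) (v : 'M[R]_(n, m)) (j : 'I_m) :
    {set 'I_n} :=
  [set i | 0 < v i j].

Definition like_prob (R : realFieldType) (n m : nat) (v : 'M[R]_(n, m))
    (i : 'I_n) (j : 'I_m) : R :=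
  if 0 < v i j then #|bidders v j|%:R^-1 else 0.

Lemma bidders_prefix (R : realFieldType) (n m : nat) (v : 'M[R]_(n, m.+1)) j :
  bidders (prefix_mx v) j = bidders v (widen_ord (leqnSn m) j).
Proof. by apply/setP => i; rewrite !inE mxE. Qed.

Lemma like_prob_prefix (R : realFieldType) (n m : nat) (v : 'M[R]_(n, m.+1)) i j :
  like_prob (prefix_mx v) i j = like_prob v i (widen_ord (leqnSn m) j).
Proof. by rewrite /like_prob bidders_prefix mxE. Qed.

Lemma like_prob_ge0 (R : realFieldType) (n m : nat) (v : 'M[R]_(n, m)) i j :
  0 <= like_prob v i j.
Proof. by rewrite /like_prob; case: ifP => // _; rewrite invr_ge0 ler0n. Qed.

Lemma like_prob_le1 (R : realFieldType) (n m : nat) (v : 'M[R]_(n, m)) i j :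
  like_prob v i j <= 1.
Proof.
rewrite /like_prob; case: ifP => [vij|_]; last exact: ler01.
have b0 : (0 < #|bidders v j|)%N by apply/card_gt0P; exists i; rewrite inE.
by rewrite invf_le1 ?ltr0n // ler1n.
Qed.

(** The Like rule ignores the earlier allocation, so at the last item it factors out of the sum over
    allocations. *)
Lemma agent_prob_like (R : realFieldType) (n m : nat) (v : 'M[R]_(n, m)) i j :
  agent_prob (like_mechanism R n) v i j = like_prob v i j.
Proof.
elim: m v j => [|m IHm] v j; first by case: j.
case: (unliftP ord_max j) => [h|] ->.
  by rewrite -widen_lift -like_prob_prefix -IHm /agent_prob outcome_prob_prefix.
rewrite /agent_prob outcome_prob_last /= -mulr_suml alloc_prob_sum1 mul1r.
by rewrite inE.
Qed.

(** * Expected utilities, limits in an ordered field, and sums over bidders *)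

Lemma exp_utilS (R : realFieldType) (n m : nat) (M : mechanism R n)
    (u v : 'M[R]_(n, m.+1)) i k :
  exp_util M u v i k =
  exp_util M (prefix_mx u) (prefix_mx v) i k + agent_prob M v k ord_max * u i ord_max.
Proof.
rewrite /exp_util big_ord_recr /=; congr (_ + _); apply: eq_bigr => h _.
by rewrite /agent_prob outcome_prob_prefix mxE.
Qed.

(** This holds in every ordered field, Archimedean or not, since [w] ranges over the field itself:
    for positive [a], the choice [w = (c + 1) / a] makes the product exceed [c]. *)
Lemma archi_bound (R : realFieldType) (a c : R) :
  (forall w, 0 < w -> a * w <= c) -> a <= 0.
Proof.
move=> H; rewrite leNgt; apply/negP => a0.
have c0 : 0 <= c by apply: le_trans (H 1 ltr01); rewrite mulr1 ltW.
have w0 : 0 < (c + 1) / a by rewrite divr_gt0 // ltr_wpDl.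
have := H _ w0; rewrite mulrC divfK ?gt_eqF //; lra.
Qed.

Lemma eps_bound (R : realFieldType) (a c : R) :
  (forall e, 0 < e -> a <= c * e) -> a <= 0.
Proof.
move=> H; apply: (@archi_bound R a c) => w w0.
have := H w^-1; rewrite invr_gt0 => /(_ w0).
by rewrite -(ler_pM2r w0) mulfVK // gt_eqF.
Qed.

Lemma exp_util_ge0 (R : realFieldType) (n m : nat) (M : mechanism R n)
    (u v : 'M[R]_(n, m)) i k : nonneg_mx u -> 0 <= exp_util M u v i k.
Proof. by move=> u0; apply: sumr_ge0 => h _; rewrite mulr_ge0 ?agent_prob_ge0. Qed.

Lemma sum_bidders_agent_prob (R : realFieldType) (n m : nat) (M : mechanism R n)
    (v : 'M[R]_(n, m)) i j :
  non_wasteful M -> nonneg_mx v -> 0 < v i j ->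
  \sum_(k in bidders v j) agent_prob M v k j = 1.
Proof.
move=> hM v0 vij; have [hpos _] := hM m v v0 j.
rewrite -hpos; last by exists i.
by apply: eq_bigl => k; rewrite inE.
Qed.

Lemma sum_bidders_like_prob (R : realFieldType) (n m : nat) (v : 'M[R]_(n, m)) i j :
  0 < v i j -> \sum_(k in bidders v j) like_prob v k j = 1.
Proof.
move=> vij; rewrite (eq_bigr (fun=> #|bidders v j|%:R^-1)); last first.
  by move=> k; rewrite inE /like_prob => ->.
rewrite sumr_const -[LHS]mulr_natl divff // pnatr_eq0 -lt0n.
by apply/card_gt0P; exists i; rewrite inE.
Qed.

(** The differences are nonnegative and sum to 0. This turns a one-sided bound for every bidder into
    equality, as both families of probabilities sum to 1. *)
Lemma eq_of_le_sum (R : realFieldType) (I : finType) (A : {set I}) (f g : I -> R) :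
  {in A, forall i, f i <= g i} -> \sum_(i in A) f i = \sum_(i in A) g i ->
  {in A, f =1 g}.
Proof.
move=> le_fg eqs i iA; apply/eqP; rewrite eq_sym -subr_eq0; apply/eqP.
have nn k : k \in A -> 0 <= g k - f k by move=> kA; rewrite subr_ge0 le_fg.
apply: (psumr_eq0P nn) iA.
by rewrite sumrB eqs subrr.
Qed.

(** * Profiles with a bid for every item: varying the last bid *)

Definition set_last_bid (R : realFieldType) (n m : nat) (u : 'M[R]_(n, m.+1))
    (i : 'I_n) (w : R) : 'M[R]_(n, m.+1) :=
  misreport u i (\row_h if h == ord_max then w else u i h).

Lemma set_last_bid_max (R : realFieldType) (n m : nat) (u : 'M[R]_(n, m.+1)) i w :
  set_last_bid u i w i ord_max = w.
Proof. by rewrite !mxE !eqxx. Qed.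

Lemma prefix_set_last_bid (R : realFieldType) (n m : nat) (u : 'M[R]_(n, m.+1)) i w :
  prefix_mx (set_last_bid u i w) = prefix_mx u.
Proof.
apply/matrixP => k h; rewrite !mxE widen_lift [lift _ _ == _]eq_sym (negbTE (neq_lift _ _)).
by case: eqP => // ->.
Qed.

Lemma set_last_bid_gt0 (R : realFieldType) (n m : nat) (u : 'M[R]_(n, m.+1)) i w k h :
  0 < w -> 0 < u i ord_max -> (0 < set_last_bid u i w k h) = (0 < u k h).
Proof.
move=> w0 u0; rewrite !mxE; case: eqP => // ->.
by case: eqP => // ->; rewrite w0 u0.
Qed.

Lemma set_last_bid_ge0 (R : realFieldType) (n m : nat) (u : 'M[R]_(n, m.+1)) i w :
  nonneg_mx u -> 0 < w -> nonneg_mx (set_last_bid u i w).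
Proof. by move=> u0 w0 k h; rewrite !mxE; do 2![case: ifP => // _]; rewrite ltW. Qed.

(* Changing the bid of i for the last item to w does not help i, by
   strategy-proofness, while its envy on the earlier items, which is bounded
   independently of w, becomes negligible as w grows: so i gets a fair share. *)
Lemma like_prob_le_agent_prob (R : realFieldType) (n m : nat) (M : mechanism R n)
    (u : 'M[R]_(n, m.+1)) (i : 'I_n) :
  non_wasteful M -> strategy_proof M -> envy_free_ex_ante M ->
  is_instance u -> 0 < u i ord_max ->
  like_prob u i ord_max <= agent_prob M u i ord_max.
Proof.
move=> hM sp ef [u0 uex] ui0; rewrite /like_prob ui0.
set t := #|_|; set p := agent_prob _ _ _ _.
have t0 : (0 : R) < t%:R by rewrite ltr0n; apply/card_gt0P; exists i; rewrite inE.
set S := exp_util M (prefix_mx u) (prefix_mx u) i i.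
suff: 1 - t%:R * p <= 0.
  by rewrite subr_le0 => H; rewrite -(ler_pM2l t0) divff // gt_eqF.
(* Adding [q_le] below over the [t] bidders gives [w <= t * (S + p * w)], which is the inequality
   needed here. *)
apply: (@archi_bound R _ (t%:R * S)) => w w0.
pose v := set_last_bid u i w.
have v0 : nonneg_mx v by apply: set_last_bid_ge0.
have vi : is_instance v.
  by split=> // j; have [k uk] := uex j; exists k; rewrite set_last_bid_gt0.
have vb : bidders v ord_max = bidders u ord_max.
  by apply/setP => k; rewrite !inE set_last_bid_gt0.
(* With true utilities [u], the earlier items contribute equally to both sides and cancel, and
   [u i ord_max] is positive. *)
have p_le : agent_prob M v i ord_max <= p.
  have w'0 : nonneg_mx (\row_h if h == ord_max then w else u i h).
    by move=> a h; rewrite mxE; case: ifP => // _; rewrite ltW.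
  have := sp _ u (conj u0 uex) i _ w'0.
  rewrite -/(set_last_bid u i w) -/v !exp_utilS prefix_set_last_bid lerD2l.
  by rewrite ler_pM2r.
(* Here [v] is taken as the sincere profile, so that [w] is the utility of [i] for the last item. *)
have q_le k : agent_prob M v k ord_max * w <= S + p * w.
  have := ef _ v vi i k; rewrite !exp_utilS prefix_set_last_bid set_last_bid_max -/S.
  have : 0 <= exp_util M (prefix_mx u) (prefix_mx u) i k.
    by apply: exp_util_ge0 => a b; rewrite mxE.
  have : agent_prob M v i ord_max * w <= p * w by rewrite ler_pM2r.
  by lra.
have vim : 0 < v i ord_max by rewrite set_last_bid_max.
have : \sum_(k in bidders v ord_max) agent_prob M v k ord_max * w <=
       \sum_(k in bidders v ord_max) (S + p * w) by apply: ler_sum.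
rewrite -mulr_suml (sum_bidders_agent_prob hM v0 vim) sumr_const vb -/t.
rewrite -mulr_natl; lra.
Qed.

Lemma agent_prob_instance_last (R : realFieldType) (n m : nat) (M : mechanism R n)
    (u : 'M[R]_(n, m.+1)) (i : 'I_n) :
  non_wasteful M -> strategy_proof M -> envy_free_ex_ante M ->
  is_instance u -> agent_prob M u i ord_max = like_prob u i ord_max.
Proof.
move=> hM sp ef uI; have [u0 _] := uI.
have [ui0|ui0] := boolP (0 < u i ord_max); last first.
  by rewrite (non_wasteful_agent_prob_eq0 hM) // /like_prob (negbTE ui0).
symmetry.
apply: (eq_of_le_sum (A := bidders u ord_max)
  (f := fun k => like_prob u k ord_max) (g := fun k => agent_prob M u k ord_max)).
- by move=> k; rewrite inE => uk; apply: like_prob_le_agent_prob.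
- by rewrite (sum_bidders_agent_prob hM u0 ui0) (sum_bidders_like_prob ui0).
- by rewrite inE.
Qed.

(** * Profiles in which some items receive no bid *)

Definition fill_unbid (R : realFieldType) (n m : nat) (v : 'M[R]_(n, m))
    (i : 'I_n) (e : R) : 'M[R]_(n, m) :=
  \matrix_(k, h) if (k == i) && (bidders v h == set0) then e else v k h.

Lemma fill_unbid_bid (R : realFieldType) (n m : nat) (v : 'M[R]_(n, m)) i e j k h :
  0 < v j h -> fill_unbid v i e k h = v k h.
Proof.
move=> vjh; rewrite mxE; case: eqP => //= _; case: eqP => // b0.
by have := in_set0 j; rewrite -b0 inE vjh.
Qed.

Lemma like_prob_fill_unbid (R : realFieldType) (n m : nat) (v : 'M[R]_(n, m))
    i e j k h :
  0 < v j h -> like_prob (fill_unbid v i e) k h = like_prob v k h.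
Proof.
move=> vjh; rewrite /like_prob (fill_unbid_bid _ _ _ vjh).
have -> // : bidders (fill_unbid v i e) h = bidders v h.
by apply/setP => l; rewrite !inE (fill_unbid_bid _ _ _ vjh).
Qed.

Lemma fill_unbid_instance (R : realFieldType) (n m : nat) (v : 'M[R]_(n, m)) i e :
  nonneg_mx v -> 0 < e -> is_instance (fill_unbid v i e).
Proof.
move=> v0 e0; split=> [k h|h].
  by rewrite mxE; case: ifP => // _; rewrite ltW.
have [b0|/set0Pn[k]] := eqVneq (bidders v h) set0.
  by exists i; rewrite mxE b0 !eqxx.
by rewrite inE => vk; exists k; rewrite (fill_unbid_bid _ _ _ vk).
Qed.

(** For nonnegative [v] and positive [e] the filled profile is an instance, so strategy-proofness
    says something about [v] even if [v] itself is not one. *)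
Lemma misreport_fill_unbid (R : realFieldType) (n m : nat) (v : 'M[R]_(n, m)) i e :
  misreport (fill_unbid v i e) i (row i v) = v.
Proof. by apply/matrixP => k h; rewrite !mxE; case: eqP => [->|]. Qed.

(* An agent with utility e for the items nobody bids for can withhold its bids
   for them; as e tends to 0 this loss vanishes, so strategy-proofness bounds
   its gain on the last item. *)
Lemma agent_prob_le_like_prob (R : realFieldType) (n m : nat) (M : mechanism R n)
    (v : 'M[R]_(n, m.+1)) (i : 'I_n) :
  non_wasteful M -> strategy_proof M -> envy_free_ex_ante M ->
  (forall v' : 'M[R]_(n, m), nonneg_mx v' ->
    forall i j, agent_prob M v' i j = like_prob v' i j) ->
  nonneg_mx v -> 0 < v i ord_max ->
  agent_prob M v i ord_max <= like_prob v i ord_max.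
Proof.
move=> hM sp ef IH v0 vi0; rewrite -subr_le0 -(pmulr_lle0 _ vi0).
(* Withholding loses at most [e] on each of the [m] earlier items. *)
apply: (@eps_bound R _ m%:R) => e e0.
pose u := fill_unbid v i e.
have uI : is_instance u by apply: fill_unbid_instance.
have pre0 (x : 'M[R]_(n, m.+1)) : nonneg_mx x -> nonneg_mx (prefix_mx x).
  by move=> x0 k h; rewrite mxE.
have r0 : nonneg_mx (row i v) by move=> k h; rewrite mxE.
have := sp _ u uI i _ r0; rewrite misreport_fill_unbid !exp_utilS.
(* The last item has a bid in [v], so filling changes neither its bidders nor its Like
   probabilities. *)
rewrite (agent_prob_instance_last _ hM sp ef uI).
rewrite (like_prob_fill_unbid _ _ _ vi0) (fill_unbid_bid _ _ _ vi0).
suff : exp_util M (prefix_mx u) (prefix_mx u) i i <=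
       exp_util M (prefix_mx u) (prefix_mx v) i i + m%:R * e by lra.
have -> : m%:R * e = \sum_(h < m) e by rewrite sumr_const card_ord mulr_natl.
rewrite -big_split; apply: ler_sum => h _ /=.
have [u0 _] := uI; rewrite (IH _ (pre0 _ u0)) (IH _ (pre0 _ v0)).
rewrite !like_prob_prefix mxE; set h' := widen_ord _ _.
(* An item with a bid in [v] contributes the same under [u] and [v]; an unbid one has utility [e]
   and probability at most 1. *)
have [b0|/set0Pn[k]] := eqVneq (bidders v h') set0; last first.
  rewrite inE => vk; rewrite (like_prob_fill_unbid _ _ _ vk) lerDl; exact: ltW.
have -> : u i h' = e by rewrite mxE b0 !eqxx.
apply: (@le_trans _ _ e); first by rewrite ler_piMl ?like_prob_le1 ?ltW.
by rewrite lerDr mulr_ge0 ?like_prob_ge0 ?ltW.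
Qed.

(** Induction on the number of items: the upper bound for the last item relies on the formula for
    all profiles of the earlier ones. *)
Lemma agent_probE (R : realFieldType) (n m : nat) (M : mechanism R n)
    (v : 'M[R]_(n, m)) i j :
  non_wasteful M -> strategy_proof M -> envy_free_ex_ante M ->
  nonneg_mx v -> agent_prob M v i j = like_prob v i j.
Proof.
move=> hM sp ef; elim: m v i j => [|m IHm] v i j v0; first by case: j.
case: (unliftP ord_max j) => [h|] ->.
  rewrite -widen_lift /agent_prob outcome_prob_prefix -like_prob_prefix.
  by rewrite -IHm // => k l; rewrite mxE.
have [vi0|vi0] := boolP (0 < v i ord_max); last first.
  by rewrite (non_wasteful_agent_prob_eq0 hM) // /like_prob (negbTE vi0).
apply: (eq_of_le_sum (A := bidders v ord_max)
  (f := fun k => agent_prob M v k ord_max) (g := fun k => like_prob v k ord_max)).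
- move=> k; rewrite inE => vk; apply: agent_prob_le_like_prob => //.
  by move=> v' v'0 a b; apply: IHm.
- by rewrite (sum_bidders_agent_prob hM v0 vi0) (sum_bidders_like_prob vi0).
- by rewrite inE.
Qed.

(** * Strategy-proofness and envy-freeness of Like, item by item *)

Lemma like_strategy_proof (R : realFieldType) (n m : nat) (u : 'M[R]_(n, m)) i w h :
  nonneg_mx u -> like_prob (misreport u i w) i h * u i h <= like_prob u i h * u i h.
Proof.
move=> u0; have [ui0|ui0] := boolP (0 < u i h); last first.
  by rewrite (_ : u i h = 0) ?mulr0 //; apply/eqP; rewrite eq_le u0 leNgt ui0.
(* A positive misreport leaves the set of bidders unchanged; any other one forfeits the item. *)
rewrite ler_pM2r // {1}/like_prob; case: ifP => [wi0|_]; last exact: like_prob_ge0.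
suff -> : bidders (misreport u i w) h = bidders u h by rewrite /like_prob ui0.
apply/setP => k; rewrite !inE; have [->|ki] := eqVneq k i; first by rewrite wi0 ui0.
by rewrite mxE (negbTE ki).
Qed.

(** An agent that values the item gets the full equal share, which no other agent exceeds. *)
Lemma like_envy_free (R : realFieldType) (n m : nat) (u : 'M[R]_(n, m)) i k h :
  nonneg_mx u -> like_prob u k h * u i h <= like_prob u i h * u i h.
Proof.
move=> u0; have [ui0|ui0] := boolP (0 < u i h); last first.
  by rewrite (_ : u i h = 0) ?mulr0 //; apply/eqP; rewrite eq_le u0 leNgt ui0.
rewrite ler_pM2r // /like_prob ui0; case: ifP => // _.
by rewrite invr_ge0 ler0n.
Qed.

Theorem theorem3 (R : realFieldType) (n : nat) (M : mechanism R n)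
    (hM : non_wasteful M) :
  (strategy_proof M /\ envy_free_ex_ante M) <->
  ex_ante_equivalent M (like_mechanism R n).
Proof.
split=> [[sp ef] m v v0 i j|eqM]; first by rewrite agent_prob_like agent_probE.
split=> m u [u0 uex] i.
  move=> w w0; apply: ler_sum => h _.
  (* The misreported profile may leave items without a bid; equivalence covers it because it ranges
     over all nonnegative bids. *)
  have mis0 : nonneg_mx (misreport u i w).
    by move=> k l; rewrite mxE; case: ifP.
  by rewrite !eqM // !agent_prob_like like_strategy_proof.
move=> k; apply: ler_sum => h _.
by rewrite !eqM // !agent_prob_like like_envy_free.
Qed.
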